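(* There is an absolute constant $c$ such that for every (sufficiently large) $n$ there is an oriented graph $G$ with $c\,n^2(\log n)^2$ edges such that every coloring of $E(G)$ with the two colors red and blue contains a red directed path of length $n$ or a blue directed path of length $n\log n$.
   Context: An oriented graph is a directed graph with no loops, no parallel edges and no pair of antiparallel edges. The length of a directed path is its number of edges. A red (blue) directed path is one all of whose edges are red (blue). Logarithms are base $2$. *)

(* Defs.v *)
From mathcomp Require Import all_boot all_order all_algebra.
From mathcomp Require Import reals exp.

Set Implicit Arguments.
Unset Strict Implicit.
Unset Printing Implicit Defensive.

Import GRing.Theory Num.Theory.
Local Open Scope ring_scope.

Definition log2 (R : realType) (x : R) : R := ln x / ln 2.

(* A digraph on V without parallel edges is a relation [G : rel V], where
   [G x y] means that x -> y is an edge. *)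
Definition oriented_graph (V : finType) (G : rel V) : Prop :=
  (forall x, ~~ G x x) /\ (forall x y, G x y -> ~~ G y x).

Definition edges (V : finType) (G : rel V) : {set V * V} :=
  [set e | G e.1 e.2].

Definition color := bool.
Definition red : color := true.
Definition blue : color := false.

(* A colouring of the edges is a total function on pairs of vertices; its
   values on pairs that are not edges are never used. *)
Definition coloring (V : finType) := V * V -> color.

(* The vertices of the path are x :: p, so its number of edges is [size p]. *)
Definition has_mono_path (V : finType) (G : rel V) (f : coloring V)
    (c : color) (l : nat) : Prop :=
  exists (x : V) (p : seq V),
    [/\ path [rel u v | G u v && (f (u, v) == c)] x p,
        uniq (x :: p) & size p = l].

(* Main.v *)
(* Take a random tournament G on Theta(n log n) vertices, in which any two
   disjoint sets of k = Theta(log n) vertices are joined by an edge in each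
   direction, and suppose that there is no red path of length n.  By Gallai-Roy
   the vertices split into n classes with no red edge inside, so almost all
   vertices lie in 2n + 3 disjoint blocks of 8k vertices, each spanning only
   blue edges.  For an ordered pair (B, B') of blocks, either every set of 2k
   vertices of B has at least 2k red out-neighbours in B', or all edges from
   some 2k vertices of B to all but fewer than 2k vertices of B' are blue.  This
   2-colours the complete symmetric digraph on the blocks, whose vertices can be
   covered by a path of the first kind and a disjoint path of the second kind.
   The first follows a red path with one vertex per block, so it has at most n
   blocks; the second follows a blue path that picks up more than 2k vertices in
   each of its inner blocks, hence one of length at least 2k(n + 1).

   The covering statement is proved by counting.  Let B and R be the
   multilinear generating functions, over vertex sets, of the Hamiltonian paths
   of the two colours.  Pulling out the cycle through a vertex y shows that
   B * R = B0 * R0 * (1 + x_y * P), where B0 and R0 are the generating functions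
   without y and P counts twice the monochromatic cycles through y with an odd
   number of vertices, the single vertex y counting as one such cycle.
   Hence every coefficient of B * R is positive. *)
Require Import Defs.
From HB Require Import structures.
From mathcomp Require Import all_boot all_order all_algebra.
From mathcomp Require Import reals exp boolp.
From mathcomp Require Import zify ring.

Set Implicit Arguments.
Unset Strict Implicit.
Unset Printing Implicit Defensive.

Import Order.TTheory GRing.Theory Num.Theory.

(** * Set functions as multilinear polynomials *)

Definition setfun (V : finType) := {ffun {set V} -> int}.
Identity Coercion ffun_of_setfun : setfun >-> finfun_of.

HB.instance Definition _ (V : finType) :=
  GRing.Zmodule.copy (setfun V) {ffun {set V} -> int}.

Section SetFun.
Local Open Scope ring_scope.
Variable V : finType.
Implicit Types (f g h : setfun V) (S A B : {set V}).

Definition setfun_one : setfun V := [ffun S => (S == set0)%:R].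
(** With [f] read as the sum of [f S] times the monomial of [S], this is the product of polynomials
    whose variables all square to 0. *)
Definition setfun_mul f g : setfun V :=
  [ffun S : {set V} => \sum_(A : {set V} | A \subset S) f A * g (S :\: A)].

Lemma setfun_mulC : commutative setfun_mul.
Proof.
move=> f g; apply/ffunP => S; rewrite !ffunE.
rewrite (reindex_onto (setD S) (setD S)) /=; last first.
  by move=> A AS; rewrite setDDr setDv set0U; apply/setIidPr.
apply: eq_big => [A|A].
  rewrite subsetDl /= setDDr setDv set0U; apply/eqP/idP => [/setIidPr //|/setIidPr //].
by case/andP => _ /eqP ->; rewrite mulrC.
Qed.

Lemma setfun_mulA : associative setfun_mul.
Proof.
move=> f g h; apply/ffunP => S; rewrite !ffunE.
transitivity (\sum_(B : {set V} | B \subset S)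
   \sum_(A : {set V} | (A \subset S) && (B \subset A))
     f B * g (A :\: B) * h (S :\: A)); last first.
  rewrite (exchange_big_dep (fun A : {set V} => A \subset S)) /=; last first.
    by move=> B A _ /andP[].
  apply: eq_bigr => A AS; rewrite ffunE mulr_suml; apply: eq_bigl => B.
  by case BA: (B \subset A); rewrite ?andbF // (subset_trans BA AS) AS.
apply: eq_bigr => B BS; rewrite ffunE mulr_sumr.
rewrite [RHS](reindex_onto (fun C => B :|: C) (fun A => A :\: B)) /=; last first.
  by move=> A /andP[_ BA]; rewrite -[RHS](setID A B) (setIidPr BA).
apply: eq_big => [C|C CSB].
  rewrite subsetUl andbT subUset BS /= setDUl setDv set0U.
  rewrite subsetD; congr (_ && _); apply/idP/eqP => [|<-].
    by move/setDidPl.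
  by apply/setDidPl; rewrite setDDl setUid.
have /andP[CS CB] : (C \subset S) && [disjoint C & B] by rewrite -subsetD.
rewrite setDUl setDv set0U (setDidPl CB) setDDl.
by rewrite mulrA.
Qed.

Lemma setfun_mul1 : left_id setfun_one setfun_mul.
Proof.
move=> f; apply/ffunP => S; rewrite ffunE (bigD1 set0) ?sub0set //= big1.
  by rewrite ffunE eqxx mul1r setD0 addr0.
by move=> A /andP[_ /negbTE A0]; rewrite ffunE A0 mul0r.
Qed.

Lemma setfun_mulDl : left_distributive setfun_mul +%R.
Proof.
move=> f g h; apply/ffunP => S; rewrite !ffunE -big_split /=.
by apply: eq_bigr => A _; rewrite ffunE mulrDl.
Qed.

Lemma setfun_oner_neq0 : setfun_one != 0.
Proof. by apply/eqP => /ffunP /(_ set0); rewrite !ffunE eqxx. Qed.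

HB.instance Definition _ := GRing.Zmodule_isComNzRing.Build (setfun V)
  setfun_mulA setfun_mulC setfun_mul1 setfun_mulDl setfun_oner_neq0.

Lemma mulfE f g S : (f * g) S = \sum_(A : {set V} | A \subset S) f A * g (S :\: A).
Proof. by rewrite ffunE. Qed.

Lemma addfE f g S : (f + g) S = f S + g S.
Proof. by rewrite ffunE. Qed.

Lemma sumfE (I : Type) (s : seq I) (P : pred I) (F : I -> setfun V) S :
  (\sum_(i <- s | P i) F i) S = \sum_(i <- s | P i) F i S.
Proof. by elim/big_rec2: _ => [|i x y _ <-]; rewrite ffunE. Qed.

Definition dirac (u : V) : setfun V := [ffun S => (S == [set u])%:R].

Lemma dirac_mulE u f S : (dirac u * f) S = if u \in S then f (S :\ u) else 0.
Proof.
rewrite mulfE; case: ifPn => uS.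
  rewrite (bigD1 [set u]) ?sub1set //= big1 => [|A /andP[_ /negbTE A0]].
    by rewrite ffunE eqxx mul1r addr0.
  by rewrite ffunE A0 mul0r.
rewrite big1 // => A AS; rewrite ffunE; case: eqP => [Au|]; last by rewrite mul0r.
by move: AS; rewrite Au sub1set (negbTE uS).
Qed.

Lemma dirac_sqr u : dirac u * dirac u = 0.
Proof.
apply/ffunP => S; rewrite dirac_mulE !ffunE; case: ifP => // uS.
by case: eqP => // /setP/(_ u); rewrite !inE eqxx.
Qed.

Definition nneg f := forall S, 0 <= f S.

Lemma nneg0 : nneg 0. Proof. by move=> S; rewrite ffunE. Qed.
Lemma nneg1 : nneg 1. Proof. by move=> S; rewrite ffunE ler0n. Qed.

Lemma nnegD f g : nneg f -> nneg g -> nneg (f + g).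
Proof. by move=> f0 g0 S; rewrite ffunE addr_ge0. Qed.

Lemma nnegM f g : nneg f -> nneg g -> nneg (f * g).
Proof.
by move=> f0 g0 S; rewrite mulfE sumr_ge0 // => A _; rewrite mulr_ge0.
Qed.

Lemma nneg_sum (I : finType) (F : I -> setfun V) :
  (forall i, nneg (F i)) -> nneg (\sum_i F i).
Proof. by move=> F0 S; rewrite sumfE sumr_ge0 // => i _; apply: F0. Qed.

Lemma nneg_dirac u : nneg (dirac u).
Proof. by move=> S; rewrite ffunE ler0n. Qed.

(* Giving weight 0 to the vertices outside D deletes them from the digraph. *)
Definition xdirac (D : {set V}) u : setfun V := if u \in D then dirac u else 0.

Lemma nneg_xdirac D u : nneg (xdirac D u).
Proof. by rewrite /xdirac; case: ifP => _; [apply: nneg_dirac | apply: nneg0]. Qed.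

Lemma xdirac_mulE D u f S :
  (xdirac D u * f) S = if (u \in D) && (u \in S) then f (S :\ u) else 0.
Proof.
rewrite /xdirac; case: ifP => _ /=; first by rewrite dirac_mulE.
by rewrite mul0r ffunE.
Qed.

(* The system e u = x_u * (a u + sum_v e v * m v u) has a unique solution since
   the weights x_u are nilpotent.  With a = 1 and m the adjacency matrix, e u is
   the generating function of the vertex sets of the paths that end in u. *)
Section LinearSystem.
Variables (D : {set V}) (a : V -> setfun V) (m : V -> V -> setfun V).

Definition step (e : V -> setfun V) : V -> setfun V :=
  fun u => xdirac D u * (a u + \sum_v e v * m v u).

Definition solve : V -> setfun V := iter #|V|.+1 step (fun=> 0).

(** The factor [xdirac D u] evaluates the rest at [S :\ u], so each [step] gains one unit of
    cardinality. *)
Lemma step_agree n (e e' : V -> setfun V) :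
  (forall u S, (#|S| < n)%N -> e u S = e' u S) ->
  forall u S, (#|S| < n.+1)%N -> step e u S = step e' u S.
Proof.
move=> ee' u S Sn; rewrite !xdirac_mulE; case: ifP => // /andP[_ uS].
rewrite !addfE !sumfE; congr (_ + _); apply: eq_bigr => v _.
rewrite !mulfE; apply: eq_bigr => A ASu; congr (_ * _); apply: ee'.
rewrite (leq_ltn_trans (subset_leq_card ASu)) //.
by move: Sn; rewrite (cardsD1 u S) uS.
Qed.

Lemma solveE u : solve u = xdirac D u * (a u + \sum_v solve v * m v u).
Proof.
suff agree n : forall u S, (#|S| < n)%N ->
    iter n step (fun=> 0) u S = iter n.+1 step (fun=> 0) u S.
  by apply/ffunP => S; apply: (agree #|V|.+1); rewrite ltnS max_card.
by elim: n => // n IHn v S Sn; apply: (step_agree IHn v Sn).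
Qed.

Lemma solve_unique e :
  (forall u, e u = xdirac D u * (a u + \sum_v e v * m v u)) -> forall u, e u = solve u.
Proof.
move=> eE u; suff agree n : forall u S, (#|S| < n)%N -> e u S = solve u S.
  by apply/ffunP => S; apply: (agree #|V|.+1); rewrite ltnS max_card.
elim: n => // n IHn v S Sn; rewrite eE solveE; exact: (step_agree IHn v Sn).
Qed.

Lemma solve_ind (P : (V -> setfun V) -> Prop) :
  P (fun=> 0) -> (forall e, P e -> P (step e)) -> P solve.
Proof.
by move=> P0 PS; rewrite /solve; elim: #|V|.+1 => [|n Pn] /=;
  [exact: P0 | exact: PS].
Qed.

Lemma solve_out u : u \notin D -> solve u = 0.
Proof. by move=> /negbTE uD; rewrite solveE /xdirac uD mul0r. Qed.

Lemma solve_nneg : (forall u, nneg (a u)) -> (forall u v, nneg (m u v)) ->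
  forall u, nneg (solve u).
Proof.
move=> a0 m0; apply: (@solve_ind (fun e => forall u, nneg (e u))) => [u|e e0 u].
  exact: nneg0.
apply: nnegM; first exact: nneg_xdirac.
by apply: nnegD => //; apply: nneg_sum => v; apply: nnegM.
Qed.

End LinearSystem.

(** Parity argument: [p - q] is twice the terms with an odd number of factors [m], [p + q] twice
    those with an even number, and each step builds either one from the other. *)
Lemma solve_sub_nneg D (a : V -> setfun V) (m : V -> V -> setfun V) :
  (forall u, nneg (a u)) -> (forall u v, nneg (m u v)) ->
  forall u, nneg (solve D a m u - solve D a (fun u v => - m u v) u).
Proof.
move=> a0 m0 u; rewrite /solve.
suff: forall n, let p := iter n (step D a m) (fun=> 0) in
   let q := iter n (step D a (fun u v => - m u v)) (fun=> 0) in
   forall u, nneg (p u - q u) /\ nneg (p u + q u).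
  by move=> /(_ #|V|.+1 u)[].
elim=> [|n IHn] p q v; first by rewrite /p /q /= subr0 addr0; split; apply: nneg0.
rewrite {}/p {}/q /=; move: IHn; set p := iter n _ _; set q := iter n _ _ => IHn.
have sumN w : \sum_u q u * - m u w = - \sum_u q u * m u w.
  by rewrite -sumrN; apply: eq_bigr => i _; rewrite mulrN.
split.
  rewrite /step sumN -mulrBr.
  apply: nnegM; first exact: nneg_xdirac.
  have -> : a v + \sum_u p u * m u v - (a v - \sum_u q u * m u v)
     = \sum_u (p u + q u) * m u v.
    under [RHS]eq_bigr do rewrite mulrDl.
    by rewrite big_split /=; ring.
  by apply: nneg_sum => w; apply: nnegM => //; case: (IHn w).
rewrite /step sumN -mulrDr.
apply: nnegM; first exact: nneg_xdirac.
have -> : a v + \sum_u p u * m u v + (a v - \sum_u q u * m u v)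
   = a v + a v + \sum_u (p u - q u) * m u v.
  under [\sum_u (p u - q u) * _]eq_bigr do rewrite mulrBl.
  by rewrite sumrB /=; ring.
apply: nnegD; first exact: nnegD.
by apply: nneg_sum => w; apply: nnegM => //; case: (IHn w).
Qed.

(** * Pulling one vertex out of the path generating function *)

Section Pull.
Variables (b r : V -> V -> setfun V).
Hypothesis brD : forall u v, b u v + r u v = 1.
Let rE u v : r u v = 1 - b u v.
Proof. by rewrite -(brD u v); ring. Qed.
Definition paths D b : setfun V := 1 + \sum_u solve D (fun=> 1) b u.

Lemma sum_complement (e : V -> setfun V) u :
  \sum_v e v * b v u = \sum_v e v + \sum_v e v * - r v u.
Proof.
by rewrite -big_split /=; apply: eq_bigr => v _; rewrite rE; ring.
Qed.

Variable (D : {set V}) (y : V).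
Hypothesis yD : y \notin D.

(* The paths avoiding y that end in a given vertex (e, n) or that extend the
   vertex y to a given vertex (c, c'); n and c' count paths of colour r with
   alternating signs. *)
Let e := solve D (fun=> 1) b.
Let n := solve D (fun=> 1) (fun u v => - r u v).
Let c := solve D (b y) b.
Let c' := solve D (r y) (fun u v => - r u v).
Let B0 := paths D b.
Let O := 1 + \sum_u c u.
Let I := 1 + \sum_u e u * b u y.

(** After [sum_complement] the source of the system for [e] is [1 + \sum_v e v], the constant [B0];
    linearity does the rest. *)
Lemma ending_at u : e u = B0 * n u.
Proof.
transitivity (solve D (fun=> B0) (fun u v => - r u v) u).
  apply: solve_unique => v; rewrite [LHS]solveE -/e sum_complement /B0 /paths -/e.
  by rewrite addrA.
apply/esym; apply: (@solve_unique _ _ _ (fun u => B0 * n u)) => v.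
rewrite [n v]solveE -/n mulrCA mulrDr mulr1 mulr_sumr.
by under [in RHS]eq_bigr do rewrite -mulrA.
Qed.

(** Adding the two systems merges the sources [b y] and [r y] into 1, so the total source is [O],
    the same at every vertex. *)
Lemma starting_at u : c u + c' u = O * n u.
Proof.
transitivity (solve D (fun=> O) (fun u v => - r u v) u).
  apply: (@solve_unique _ _ _ (fun u => c u + c' u)) => v.
  under [in RHS]eq_bigr do rewrite mulrDl.
  rewrite [c v]solveE [c' v]solveE -/c -/c' -mulrDr sum_complement /O.
  by rewrite big_split /= rE; congr (_ * _); ring.
apply/esym; apply: (@solve_unique _ _ _ (fun u => O * n u)) => v.
rewrite [n v]solveE -/n mulrCA mulrDr mulr1 mulr_sumr.
by under [in RHS]eq_bigr do rewrite -mulrA.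
Qed.

(* The cycles through y of colour b, and those of colour r with a sign, the 1
   standing for y alone: this is the logarithmic derivative of [paths] at y. *)
Definition pulled D b r y : setfun V :=
  1 + \sum_u solve D (b y) b u * b u y
    - \sum_u solve D (r y) (fun u v => - r u v) u * r u y.

(** Since [1 - \sum_u n u] inverts [B0], both [I] and [O] can be expressed through [B0], [n] and
    [c']. *)
Lemma IO_pulled : I * O = B0 * pulled D b r y.
Proof.
have B0n : B0 * (1 - \sum_u n u) = 1.
  rewrite mulrBr mulr1 mulr_sumr /B0 /paths -/e -/B0.
  by under [X in _ - X]eq_bigr do rewrite -ending_at; ring.
have On : O * (1 - \sum_u n u) = 1 - \sum_u c' u.
  rewrite mulrBr mulr1 mulr_sumr; under eq_bigr do rewrite -starting_at.
  by rewrite big_split /= /O; ring.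
have OB : O = B0 * (1 - \sum_u c' u) by rewrite -On mulrCA B0n mulr1.
have -> : pulled D b r y = 1 - \sum_u c' u + O * \sum_u n u * b u y.
  rewrite /pulled -/c -/c' mulr_sumr.
  under [X in _ = _ + X]eq_bigr do rewrite mulrA -starting_at mulrDl.
  have -> : \sum_u c' u * r u y = \sum_u c' u - \sum_u c' u * b u y.
    by rewrite -sumrB; apply: eq_bigr => v _; rewrite rE; ring.
  by rewrite big_split /=; ring.
have -> : I = 1 + B0 * \sum_u n u * b u y.
  rewrite /I mulr_sumr; congr (_ + _).
  by apply: eq_bigr => v _; rewrite ending_at mulrA.
by rewrite [RHS]mulrDr -OB; ring.
Qed.

(** A path avoids [y] or splits there into a part leading in ([I]) and a part leading out ([O]),
    either possibly empty. *)
Lemma pathsU : paths (y |: D) b = B0 + dirac y * (I * O).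
Proof.
(* The term [u == y] is for paths ending at [y]; second visits to [y] vanish by [dirac_sqr]. *)
pose E u := e u + dirac y * I * (c u + (u == y)%:R).
have yU u : u != y -> xdirac (y |: D) u = xdirac D u.
  by move=> /negbTE uy; rewrite /xdirac !inE uy.
have ey : e y = 0 by exact: solve_out.
have cy : c y = 0 by exact: solve_out.
have EE u : E u = solve (y |: D) (fun=> 1) b u.
  apply: solve_unique => {}u.
  have -> : \sum_v E v * b v u = \sum_v e v * b v u
      + dirac y * I * (b y u + \sum_v c v * b v u).
    have -> : b y u = \sum_v (v == y)%:R * b v u.
      rewrite (bigD1 y) //= eqxx mul1r big1 ?addr0 // => v /negbTE ->.
      by rewrite mul0r.
    rewrite -big_split /= mulr_sumr -big_split /=.
    by apply: eq_bigr => v _; rewrite /E; ring.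
  rewrite /E; have [->|uy] := eqVneq u y.
    rewrite ey cy !add0r mulr1 /xdirac setU11 /I.
    set s := \sum_v e v * b v y; set t := b y y + _.
    transitivity (dirac y * (1 + s) + dirac y * dirac y * ((1 + s) * t)); last by ring.
    by rewrite dirac_sqr; ring.
  rewrite yU // addr0 [e u]solveE [c u]solveE -/e -/c; ring.
rewrite /paths; under eq_bigr do rewrite -EE.
rewrite big_split /= -mulr_sumr big_split /=.
have -> : \sum_u (u == y)%:R = 1 :> setfun V.
  by rewrite (bigD1 y) //= eqxx big1 ?addr0 // => v /negbTE ->.
by rewrite /B0 /paths -/e /O; ring.
Qed.

Lemma paths_pull : paths (y |: D) b = paths D b * (1 + dirac y * pulled D b r y).
Proof. by rewrite pathsU IO_pulled /B0; ring. Qed.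

End Pull.

(* In the sum the cycles on an even number of vertices cancel. *)
Lemma pulled_pair_nneg b r D y :
  (forall u v, nneg (b u v)) -> (forall u v, nneg (r u v)) ->
  nneg (pulled D b r y + pulled D r b y - 1 - 1).
Proof.
move=> b0 r0; pose d m u := solve D (m y) m u - solve D (m y) (fun u v => - m u v) u.
have -> : pulled D b r y + pulled D r b y - 1 - 1
    = \sum_u d b u * b u y + \sum_u d r u * r u y.
  under [\sum_u d b u * _]eq_bigr do rewrite mulrBl.
  under [\sum_u d r u * _]eq_bigr do rewrite mulrBl.
  by rewrite !sumrB /pulled; ring.
by apply: nnegD; apply: nneg_sum => u; apply: nnegM => //; apply: solve_sub_nneg.
Qed.

Lemma paths_nneg D b : (forall u v, nneg (b u v)) -> nneg (paths D b).
Proof.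
move=> b0; apply: nnegD; first exact: nneg1.
by apply: nneg_sum => u; apply: solve_nneg => // ?; exact: nneg1.
Qed.

Lemma paths_mul_gt0 D b r : (forall u v, b u v + r u v = 1) ->
  (forall u v, nneg (b u v)) -> (forall u v, nneg (r u v)) ->
  0 < (paths D b * paths D r) D.
Proof.
move=> brD b0 r0; have rbD u v : r u v + b u v = 1 by rewrite addrC.
move: {2}#|D| (leqnn #|D|) => m; elim: m D => [|m IHm] D Dm.
  have {Dm}-> : D = set0 by apply/eqP; rewrite -cards_eq0 -leqn0.
  have paths0 w : paths set0 w = 1.
    by rewrite /paths big1 ?addr0 // => u _; rewrite solve_out ?inE.
  by rewrite !paths0 mulr1 ffunE eqxx.
have [->|[y yD]] := set_0Vmem D; first by apply: IHm; rewrite cards0.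
pose D' := D :\ y; have yD' : y \notin D' by rewrite !inE eqxx.
have D'm : (#|D'| <= m)%N by move: Dm; rewrite (cardsD1 y) yD.
rewrite -(setD1K yD) -/D' (paths_pull brD yD') (paths_pull rbD yD').
set F := pulled _ b _ _; set F' := pulled _ r _ _.
(* The subtracted units are the one-vertex cycles of the two colours; the copies of [G] they yield
   are positive at [D'] by induction. *)
set G := paths D' b * paths D' r; pose N := F + F' - 1 - 1.
have N0 : nneg N by exact: pulled_pair_nneg.
have G0 : nneg G by apply: nnegM; apply: paths_nneg.
have -> : paths D' b * (1 + dirac y * F) * (paths D' r * (1 + dirac y * F'))
   = G + dirac y * (G + (G + G * N)) + dirac y * dirac y * (G * F * F').
  by rewrite /G /N; ring.
rewrite dirac_sqr mul0r addr0 addfE dirac_mulE setU11 setU1K // !addfE.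
apply: ltr_wpDl; first exact: G0.
apply: ltr_pwDl; first exact: IHm.
by apply: addr_ge0; [apply: G0 | apply: nnegM].
Qed.

(** * Reading paths off nonzero coefficients *)

Section BicoloredCover.
Variable c : rel V.

(** A nonzero summand names the previous vertex [v], and its path avoids [u] because it lives on
    [S :\ u]. *)
Lemma solve_path (D : {set V}) u S :
  solve D (fun=> 1) (fun u v => (c u v)%:R) u S != 0 ->
  exists s : seq V, [/\ sorted c (rcons s u), uniq (rcons s u) & rcons s u =i S].
Proof.
move: u S; apply: (@solve_ind _ _ _ (fun e => forall u S, e u S != 0 -> exists s,
  [/\ sorted c (rcons s u), uniq (rcons s u) & rcons s u =i S])).
  by move=> u S; rewrite ffunE eqxx.
move=> e IHe u S.
rewrite /step xdirac_mulE; case: ifP => [/andP[_ uS]|]; last by rewrite eqxx.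
rewrite addfE sumfE; have [Su0 _|Su0] := eqVneq (S :\ u) set0.
  exists [::]; split=> // v; rewrite inE; have /setP/(_ v) := Su0; rewrite !inE.
  by case: eqP => [->|] //= _ ->.
rewrite ffunE (negbTE Su0) add0r => sum_neq0.
have /existsP[v] : [exists v, (e v * (c v u)%:R) (S :\ u) != 0].
  apply: contraNT sum_neq0; rewrite negb_exists => /forallP e0.
  by apply/eqP/big1 => v _; apply/eqP; rewrite -[_ == 0]negbK.
case cvu: (c v u); last by rewrite mulr0 ffunE eqxx.
rewrite mulr1 => /IHe[s [cs us sS]]; exists (rcons s v); split.
- case: s cs {us sS} => [|x s] /= cs; first by rewrite cvu.
  by rewrite rcons_path cs last_rcons cvu.
- by rewrite rcons_uniq us sS !inE eqxx.
by move=> w; rewrite mem_rcons inE sS !inE; case: eqP => [->|].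
Qed.

Lemma paths_path (D S : {set V}) : paths D (fun u v => (c u v)%:R) S != 0 ->
  exists s : seq V, [/\ sorted c s, uniq s & s =i S].
Proof.
have [-> _|S0] := eqVneq S set0; first by exists [::]; split=> // v; rewrite inE.
rewrite addfE ffunE (negbTE S0) add0r sumfE => sum_neq0.
have /existsP[u] : [exists u, solve D (fun=> 1) (fun u v => (c u v)%:R) u S != 0].
  apply: contraNT sum_neq0; rewrite negb_exists => /forallP e0.
  by apply/eqP/big1 => v _; apply/eqP; rewrite -[_ == 0]negbK.
by move=> /solve_path[s ?]; exists (rcons s u).
Qed.

End BicoloredCover.

Lemma bicolored_path_cover (c : rel V) :
  exists s t : seq V, [/\ sorted c s, sorted (fun u v => ~~ c u v) t,
    uniq s, uniq t & forall v, (v \in s) = (v \notin t)].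
Proof.
pose b (c : rel V) u v : setfun V := (c u v)%:R.
have b0 c' u v : nneg (b c' u v).
  by rewrite /b; case: (c' u v); [apply: nneg1 | apply: nneg0].
pose c' u v := ~~ c u v.
have bD u v : b c u v + b c' u v = 1.
  by rewrite /b /c'; case: (c u v); rewrite ?addr0 ?add0r.
have := paths_mul_gt0 [set: V] bD (b0 c) (b0 c').
rewrite mulfE => sum_gt0.
have /existsP[A] : [exists A : {set V},
    (paths setT (b c) A != 0) && (paths setT (b c') (setT :\: A) != 0)].
  apply: contraLR sum_gt0; rewrite negb_exists => /forallP e0.
  rewrite big1 ?ltxx // => A _; have := e0 A.
  by rewrite negb_and !negbK => /orP[] /eqP ->; rewrite ?mul0r ?mulr0.
case/andP => /paths_path[s [cs us sA]] /paths_path[t [ct ut tA]].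
exists s, t; split=> // v; by rewrite sA tA !inE andbT negbK.
Qed.

End SetFun.

(** * Hamiltonian paths, depth classes and blocks *)

Section Paths.
Variable V : finType.
Implicit Types (G E : rel V) (A Z : {set V}).

(* Merge sort needs only a total relation, not a transitive one. *)
Lemma tournament_ham_path G Z : {in Z &, forall u v, u != v -> G u v || G v u} ->
  exists s : seq V, [/\ sorted G s, uniq s & s =i Z].
Proof.
move=> Gtot; pose le u v := (u == v) || G u v.
have le_total : {in mem Z &, total le}.
  move=> u v uZ vZ; rewrite /le (eq_sym v).
  by have [//|/(Gtot _ _ uZ vZ)] := eqVneq u v.
exists (sort le (enum Z)); split; last by move=> v; rewrite mem_sort mem_enum.
  have Zall : all (mem Z) (enum Z) by apply/allP => v; rewrite mem_enum.
  have := sort_sorted_in le_total Zall.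
  have : uniq (sort le (enum Z)) by rewrite sort_uniq enum_uniq.
  case: (sort _ _) => //= x s us /pathP leP; apply/(pathP x) => i lti.
  have := leP x i lti; rewrite /le => /orP[|//]; move: us => /andP[].
  have -> : nth x s i = nth x (x :: s) i.+1 by [].
  move=> xs us; rewrite nth_uniq //= ?xs //; [by rewrite eqn_leq ltnn andbF | lia].
by rewrite sort_uniq enum_uniq.
Qed.

(* A colouring by depth in a spanning forest: every non-root has an edge
   coming from a vertex whose depth is one less.  An edge u -> v joining two
   vertices of equal depth lets the subtree of v be rehung below u, which
   increases the sum of the depths. *)
Lemma gallai_roy E n : irreflexive E ->
  (forall x p, path E x p -> uniq (x :: p) -> size p < n) ->
  exists h : V -> nat, (forall v, h v < n) /\ (forall u v, E u v -> h u != h v).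
Proof.
move=> Eirr En.
pose forest (pi : V -> option V) (h : V -> nat) := forall v,
  if pi v is Some u then E u v && (h v == (h u).+1) else h v == 0.
have depth_path pi h : forest pi h -> forall m v, h v = m ->
    exists x p, [/\ path E x p, uniq (x :: p), last x p = v, size p = m
      & forall w, w \in x :: p -> h w <= m].
  move=> fh; elim=> [|m IHm] v hv.
    by exists v, [::]; split=> // w; rewrite inE => /eqP ->; rewrite hv.
  move: (fh v); case: (pi v) => [u|]; last by rewrite hv.
  case/andP=> Euv; rewrite hv eqSS => /eqP/esym/IHm[x [p [xp up lp sp hp]]].
  exists x, (rcons p v); split.
  - by rewrite rcons_path xp lp.
  - rewrite -rcons_cons rcons_uniq up andbT; apply/negP => /hp.
    by rewrite hv ltnn.
  - by rewrite last_rcons.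
  - by rewrite size_rcons sp.
  move=> w; rewrite -rcons_cons mem_rcons inE => /orP[/eqP->|/hp]; [by rewrite hv|lia].
have depth_lt pi h : forest pi h -> forall v, h v < n.
  move=> /depth_path fh v; have [x [p [xp up _ <- _]]] := fh _ v erefl.
  exact: (En _ _ xp up).
(* Depths stay below [n], so their sum stays below [n * #|V|] when there are vertices; [k] bounds
   the rehangings still possible. *)
suff improve : forall k pi h, forest pi h -> n * #|V| <= k + \sum_v h v ->
    exists h : V -> nat, (forall v, h v < n) /\ (forall u v, E u v -> h u != h v).
  apply: (improve (n * #|V|) (fun=> None) (fun=> 0)) => //; exact: leq_addr.
elim=> [|k IHk] pi h fh; have hn := depth_lt _ _ fh;
  have [/existsP[u /existsP[v /andP[Euv /eqP huv]]]|noE] :=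
    boolP [exists u, [exists v, E u v && (h u == h v)]];
  try by move=> _; exists h; split=> // u v Euv; move: noE;
    rewrite negb_exists => /forallP/(_ u); rewrite negb_exists => /forallP/(_ v);
    rewrite Euv.
  rewrite add0n leqNgt; have -> // : \sum_v h v < n * #|V|.
  rewrite mulnC -sum_nat_const (bigD1 v) //= [X in _ < X](bigD1 v) //=.
  by rewrite -addSn leq_add // leq_sum // => w _; exact: ltnW.
pose up := [rel a b | pi a == Some b].
pose desc w := connect up w v.
have desc_depth w : desc w -> w = v \/ h v < h w.
  move=> /connectP[p]; elim: p w => [|z p IHp] w /=; first by move=> _ ->; left.
  case/andP=> /eqP wz /IHp zv /zv {}zv; right.
  have := fh w; rewrite wz => /andP[_ /eqP ->].
  by case: zv => [->|]; lia.
have descS w z : w != v -> pi w = Some z -> desc w = desc z.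
  move=> wv wz; apply/idP/idP => [/connectP[[|z' p] /=]|].
  - by move=> _ vw; rewrite vw eqxx in wv.
  - by rewrite wz => /andP[/eqP[<-] zp] vp; apply/connectP; exists p.
  by apply: connect_trans; apply: connect1; rewrite /= wz.
have desc_root w : w != v -> pi w = None -> desc w = false.
  move=> wv wN; apply/negP => /connectP[[|z p] /=]; last by rewrite wN.
  by move=> _ vw; rewrite vw eqxx in wv.
have descv : desc v by exact: connect0.
(* Other members of the subtree of [v] are strictly deeper than [v], so [u] is outside it and
   rehanging makes no cycle. *)
have descu : desc u = false.
  apply/negP => /desc_depth[uv|]; last by rewrite huv ltnn.
  by move: Euv; rewrite uv Eirr.
move=> kn; apply: (IHk (fun w => if w == v then Some u else pi w)
                       (fun w => h w + desc w)).
  move=> w /=; have [->|wv] := eqVneq w v.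
    by rewrite Euv descv descu huv addn0 addn1 eqxx.
  have := fh w; case wz: (pi w) => [z|].
    by case/andP=> -> /eqP ->; rewrite (descS _ _ wv wz) addSn eqxx.
  by move=> /eqP ->; rewrite desc_root.
have : 0 < \sum_w desc w by rewrite (bigD1 v) //= descv.
rewrite big_split /=; move: kn.
move: (\sum_w h w) (\sum_w desc w) (n * _) => a b' c; lia.
Qed.

Lemma subset_card_eq (A : {set V}) m : m <= #|A| ->
  exists2 Z : {set V}, Z \subset A & #|Z| = m.
Proof.
move=> mA; exists [set:: take m (enum A)].
  by apply/subsetP => v; rewrite inE => /mem_take; rewrite mem_enum.
rewrite cardsE (card_uniqP _) ?take_uniq ?enum_uniq //.
by rewrite size_takel // -cardE.
Qed.

(** Greedy choice: before each new block more than [n * s] vertices are free, so one of the [n]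
    classes keeps [s] of them. *)
Lemma disjoint_blocks (h : V -> nat) n s m : 0 < s ->
  (forall v, h v < n) -> (m + n) * s <= #|V| ->
  exists B : nat -> {set V}, [/\
    forall i, i < m -> #|B i| = s,
    forall i j, i < m -> j < m -> i != j -> [disjoint B i & B j] &
    forall i, i < m -> {in B i &, forall u v, h u = h v}].
Proof.
move=> s0 hn; elim: m => [|m IHm] mn; first by exists (fun=> set0).
have [|B [Bs Bd Bh]] := IHm; first by lia.
pose U := \bigcup_(i < m) B i.
have Um : #|U| <= m * s.
  have : #|U| <= \sum_(i < m) #|B i|.
    rewrite /U; elim/big_rec2: _ => [|i x y _ le]; first by rewrite cards0.
    by apply: leq_trans (leq_add (leqnn _) le); exact: leq_card_setU.
  by rewrite (eq_bigr (fun=> s)) ?sum_nat_const ?card_ord // => i _; apply: Bs.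
have [i si] : exists i : 'I_n, s <= #|[set v in ~: U | h v == i]|.
  apply/existsP; apply: contraT; rewrite negb_exists => /forallP small.
  suff : #|~: U| <= n * s by rewrite cardsCs setCK; lia.
  rewrite -sum1_card (partition_big (fun v => Ordinal (hn v)) xpredT) //=.
  rewrite mulnC -[n in s * n]card_ord mulnC -sum_nat_const; apply: leq_sum => i _.
  rewrite sum1_card ltnW // ltnNge; have := small i; congr (~~ (s <= _)).
  by apply: eq_card => v; rewrite in_set.
have [Z ZU Zs] := subset_card_eq si.
have BU j : j < m -> B j \subset U.
  by move=> jm; rewrite /U; apply: (bigcup_sup (Ordinal jm)).
have ZB j : j < m -> [disjoint Z & B j].
  move=> jm; apply: disjointWr (BU j jm) _; apply/pred0Pn => -[v /= /andP[vZ vU]].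
  by move: (subsetP ZU v vZ); rewrite !inE vU.
exists (fun j => if j == m then Z else B j); split=> [j|j j'|j].
- by have [//|jm jm1] := eqVneq j m; apply: Bs; lia.
- have [->|jm] := eqVneq j m; have [->|j'm] := eqVneq j' m => //.
  + by move=> *; apply: ZB; lia.
  + by move=> *; rewrite disjoint_sym; apply: ZB; lia.
  by move=> *; apply: Bd => //; lia.
have [_ _ u v uZ vZ|jm jm1] := eqVneq j m; last by apply: Bh; lia.
move: (subsetP ZU u uZ) (subsetP ZU v vZ); rewrite !inE.
by move=> /andP[_ /eqP ->] /andP[_ /eqP ->].
Qed.

End Paths.

(** * Random tournaments *)

Section Tournament.
Variable N : nat.
Implicit Types f : {ffun 'I_N * 'I_N -> bool}.

(** Each tournament arises from equally many [f], so counting functions samples tournaments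
    uniformly. *)
Definition tournament_of f : rel 'I_N :=
  fun x y => if x < y then f (x, y) else (y < x) && ~~ f (y, x).

Lemma tournament_of_irr f x : tournament_of f x x = false.
Proof. by rewrite /tournament_of ltnn. Qed.

Lemma tournament_of_anti f x y : x != y -> tournament_of f x y = ~~ tournament_of f y x.
Proof. by rewrite /tournament_of -val_eqE; case: ltngtP => //= _; rewrite negbK. Qed.

Definition no_edge (s t : seq 'I_N) := [set f |
  [forall a, [forall b, (a \in s) ==> (b \in t) ==> ~~ tournament_of f a b]]].

Lemma card_no_edge k (s t : seq 'I_N) : uniq s -> uniq t -> ~~ has (mem s) t ->
  size s = k -> size t = k ->
  #|no_edge s t| * 2 ^ (k * k) <= 2 ^ (N * N).
Proof.
move=> us ut st sk tk.
(* The bit read for a pair from [s] to [t] sits at the increasing ordering of the pair: it must be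
   [false] at [fwd] positions and [true] at [bwd] ones. *)
pose fwd (p : 'I_N * 'I_N) := [&& p.1 < p.2, p.1 \in s & p.2 \in t].
pose bwd (p : 'I_N * 'I_N) := [&& p.1 < p.2, p.1 \in t & p.2 \in s].
have stF a : a \in s -> a \in t -> False.
  by move=> sa ta; move/hasPn: st => /(_ a ta) /=; rewrite sa.
pose F p : pred bool :=
  if fwd p then pred1 false else if bwd p then pred1 true else predT.
have sub : #|no_edge s t| <= #|(family F : simpl_pred {ffun 'I_N * 'I_N -> bool})|.
  apply: subset_leq_card; apply/subsetP => f; rewrite inE => /forallP fst.
  apply/familyP => -[a b]; rewrite /F; case: ifP => [/and3P[/= ab sa tb]|_].
    have /forallP/(_ b) := fst a; rewrite sa tb /= /tournament_of ab !inE.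
    by case: (f _).
  case: ifP => // /and3P[/= ab ta sb].
  have /forallP/(_ a) := fst b; rewrite sb ta /= /tournament_of ab.
  rewrite ltnNge (ltnW ab) /= negbK.
  by rewrite inE => ->.
apply: leq_trans (leq_mul sub (leqnn _)) _.
pose special := [set p | fwd p || bwd p].
have -> : #|(family F : simpl_pred {ffun 'I_N * 'I_N -> bool})| = 2 ^ #|~: special|.
  rewrite card_family foldrE big_map big_enum /= (bigID (mem special)) /=.
  rewrite big1 ?mul1n => [|p]; last first.
    by rewrite inE /F; case: (fwd p) => /=; last move=> ->; move=> *; apply: eq_card1.
  rewrite (eq_bigr (fun=> 2)) ?prod_nat_const.
    by congr (2 ^ _); apply: eq_card => p; rewrite in_setC.
  move=> p; rewrite inE negb_or => /andP[/negbTE nf /negbTE nb].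
  by rewrite /F nf nb card_bool.
have kspecial : k * k <= #|special|.
  pose S := [set p : 'I_N * 'I_N | (p.1 \in s) && (p.2 \in t)].
  have -> : k * k = #|S|.
    have -> : S = setX [set a in s] [set b in t] by apply/setP => -[a b]; rewrite !inE.
    by rewrite cardsX !cardsE (card_uniqP us) (card_uniqP ut) sk tk.
  pose key (p : 'I_N * 'I_N) := if p.1 < p.2 then p else (p.2, p.1).
  have key_inj : {in S &, injective key}.
    move=> [a b] [a' b'] /=; rewrite !inE /key /= => /andP[sa tb] /andP[sa' tb'].
    case: ifP => _; case: ifP => _ [].
    - by move=> -> ->.
    - by move=> aE; case: (stF a sa); rewrite aE.
    - by move=> bE; case: (stF b _ tb); rewrite bE.
    by move=> -> ->.
  rewrite -(card_in_imset key_inj); apply: subset_leq_card; apply/subsetP => q.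
  case/imsetP => -[a b]; rewrite !inE /key /fwd /bwd /= => /andP[sa tb] ->.
  case: (ltngtP a b) => /= [ab|ba|/val_inj ab].
  - by rewrite ab sa tb.
  - by rewrite ba sa tb orbT.
  by case: (stF a sa); rewrite ab.
rewrite -expnD leq_exp2l //.
have -> : N * N = #|~: special| + #|special|.
  by rewrite addnC cardsC card_prod card_ord.
by rewrite leq_add2l.
Qed.

(** Union bound: [N ^ k * N ^ k] pairs of tuples, each ruling out at most a [2 ^ (k * k)]-th of all
    functions. *)
Lemma random_tournament k : 0 < k -> N * N < 2 ^ k ->
  exists G : rel 'I_N, [/\ irreflexive G,
    forall x y, x != y -> G x y = ~~ G y x &
    forall A B : {set 'I_N}, [disjoint A & B] -> k <= #|A| -> k <= #|B| ->
      exists a b, [/\ a \in A, b \in B & G a b]].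
Proof.
move=> k0 Nk.
pose T := (k.-tuple 'I_N * k.-tuple 'I_N)%type.
pose ok (t : T) := [&& uniq t.1, uniq t.2 & ~~ has (mem t.1) t.2].
pose bad (t : T) := no_edge t.1 t.2.
have bad_small : #|\bigcup_(t | ok t) bad t| * 2 ^ (k * k) <=
    N ^ k * N ^ k * 2 ^ (N * N).
  have -> : N ^ k * N ^ k = #|{: T}| by rewrite card_prod card_tuple card_ord.
  apply: (@leq_trans (\sum_(t | ok t) #|bad t| * 2 ^ (k * k))).
    rewrite -big_distrl leq_mul2r /=; apply/orP; right.
    elim/big_rec2: _ => [|i x y _ le]; first by rewrite cards0.
    by apply: leq_trans (leq_add (leqnn _) le); exact: leq_card_setU.
  rewrite -sum_nat_const [X in _ <= X](bigID ok) /= -[X in X <= _]addn0.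
  apply: leq_add => //; apply: leq_sum => -[t1 t2] /and3P[u1 u2 u12].
  by apply: (card_no_edge u1 u2 u12); rewrite size_tuple.
have /existsP[f fgood] : [exists f, f \notin \bigcup_(t | ok t) bad t].
  apply: contraT; rewrite negb_exists => /forallP allbad; move: bad_small.
  have -> : #|\bigcup_(t | ok t) bad t| = 2 ^ (N * N).
    rewrite (eq_card (B := predT)) ?card_ffun ?card_bool ?card_prod ?card_ord //.
    by move=> f; have := allbad f; rewrite negbK => ->.
  rewrite mulnC leq_pmul2r ?expn_gt0 // -expnMn leqNgt.
  by rewrite [2 ^ (k * k)]expnM ltn_exp2r // Nk.
exists (tournament_of f); split=> [x|x y|A B dAB Ak Bk].
- exact: tournament_of_irr.
- exact: tournament_of_anti.
have take_tuple (Z : {set 'I_N}) : k <= #|Z| ->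
    exists2 t : k.-tuple 'I_N, uniq t & {subset t <= Z}.
  move=> kZ; have tk : size (take k (enum Z)) == k by rewrite size_takel -?cardE.
  exists (Tuple tk); first by rewrite take_uniq ?enum_uniq.
  by move=> v /mem_take; rewrite mem_enum.
have [s us sA] := take_tuple _ Ak; have [t ut tB] := take_tuple _ Bk.
have okst : ok (s, t).
  rewrite /ok /= us ut; apply/hasPn => v tv; apply/negP => sv.
  by move/pred0P: dAB => /(_ v) /=; rewrite sA // tB.
have : f \notin bad (s, t) by apply: contra fgood => fst; apply/bigcupP; exists (s, t).
rewrite inE negb_forall => /existsP[a]; rewrite negb_forall => /existsP[b].
rewrite negb_imply => /andP[sa]; rewrite negb_imply negbK => /andP[tb Gab].
by exists a, b; split=> //; [apply: sA | apply: tB].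
Qed.
End Tournament.

(** * Paths through chains of blocks *)

Section Chains.
Variables (V : finType) (I : eqType) (B : I -> {set V}).
Implicit Types (G E F : rel V) (R : {set V}) (i j : I) (w : seq I) (p : seq V).

Definition robust E a i j := [forall R : {set V},
  (R \subset B i) && (a <= #|R|) ==> (a <= #|[set v in B j | [exists u in R, E u v]]|)].

Lemma notin_other_blocks (J : pred I) i w x p :
  {in J &, forall i j, i != j -> [disjoint B i & B j]} ->
  all J (i :: w) -> i \notin w -> x \in B i ->
  (forall v, v \in p -> exists2 j, j \in w & v \in B j) -> x \notin p.
Proof.
move=> Bd /= /andP[Ji Jw] iw xi pw; apply/negP => /pw[j jw xj].
have ij : i != j by apply: contraNneq iw => ->.
by have /pred0P/(_ x) := Bd i j Ji (allP Jw j jw) ij; rewrite /= xi xj.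
Qed.

(** [R] is arbitrary so that induction can continue from its out-neighbours; the vertex in [R] is
    picked after the rest of the path. *)
Lemma robust_path E a (J : pred I) i w R :
  {in J &, forall i j, i != j -> [disjoint B i & B j]} -> 0 < a ->
  all J (i :: w) -> uniq (i :: w) -> path (robust E a) i w ->
  R \subset B i -> a <= #|R| ->
  exists x p, [/\ x \in R, path E x p, uniq (x :: p), size p = size w &
    forall v, v \in p -> exists2 j, j \in w & v \in B j].
Proof.
move=> Bd a0; elim: w i R => [|j w IHw] i R.
  move=> _ _ _ RB aR; have /card_gt0P[x xR] : 0 < #|R| by exact: leq_trans aR.
  by exists x, [::]; split.
move=> Jiw /= /andP[iw uw] /andP[/forallP/(_ R) rob pw] RB aR.
move: rob; rewrite RB aR /=; set R' := [set v in _ | _] => aR'.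
have R'B : R' \subset B j by apply/subsetP => v; rewrite inE => /andP[].
have [|x' [p [xR' Ep up sp pB]]] := IHw j R' _ uw pw R'B aR'; first by case/andP: Jiw.
have := xR'; rewrite inE => /andP[xj /exists_inP[x xR Exx']].
have pB' v : v \in x' :: p -> exists2 j', j' \in j :: w & v \in B j'.
  rewrite inE => /orP[/eqP->|/pB[j' jw vj']]; first by exists j; rewrite ?mem_head.
  by exists j'; rewrite // inE jw orbT.
have xp : x \notin x' :: p.
  by apply: notin_other_blocks Bd Jiw iw _ pB'; exact: (subsetP RB).
by exists x, (x' :: p); split=> //=;
  [rewrite Exx' | rewrite -/(uniq (x' :: p)) xp | rewrite sp].
Qed.

Definition open_pair G F a i j := exists R Y : {set V},
  [/\ R \subset B i, #|R| = a, Y \subset B j, #|B j| < #|Y| + a &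
      {in R & Y, forall u v, G u v -> F u v}].

Lemma not_robust G E F a i j : (forall u v, G u v -> E u v || F u v) ->
  ~~ robust E a i j -> open_pair G F a i j.
Proof.
move=> EF; rewrite negb_forall => /existsP[R0]; rewrite negb_imply -ltnNge.
case/andP=> /andP[R0B aR0]; have [R RR0 Ra] := subset_card_eq aR0.
set N := [set v in _ | _] => Na.
exists R, (B j :\: N); split=> //.
- exact: subset_trans RR0 R0B.
- exact: subsetDl.
- have NB : N \subset B j by apply/subsetP => v; rewrite inE => /andP[].
  by rewrite cardsD (setIidPr NB); have := subset_leq_card NB; lia.
move=> u v uR; rewrite !inE => /andP[vN vj] /EF/orP[Euv|//].
case/negP: vN; rewrite vj; apply/exists_inP; exists u => //.
exact: (subsetP RR0).
Qed.

(** Entering in [qa] and leaving in [qb] forces a passage through all of [qm]. *)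
Lemma sorted_segment F qa qm qb z t : sorted F (qa ++ qm ++ qb) ->
  uniq (qa ++ qm ++ qb) -> z \in qa -> t \in qb ->
  exists q, [/\ path F z q, uniq (z :: q), last z q = t, size qm < size q &
    {subset z :: q <= qa ++ qm ++ qb}].
Proof.
move=> Fq uq za tb; case/splitPr: za Fq uq => q1 q2; case/splitPr: tb => q3 q4.
rewrite -catA => /cat_sorted2[_ /=]; rewrite cat_uniq => Fq /and3P[_ _ uq].
exists (q2 ++ qm ++ rcons q3 t).
have E : q2 ++ qm ++ q3 ++ t :: q4 = (q2 ++ qm ++ rcons q3 t) ++ q4.
  by rewrite -cats1 -!catA.
split.
- by move: Fq; rewrite E cat_path => /andP[].
- by move: uq; rewrite /= E cat_uniq mem_cat negb_or => /andP[/andP[-> _] /andP[]].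
- by rewrite !last_cat last_rcons.
- by rewrite !size_cat size_rcons; lia.
by move=> v vq; rewrite E -cat_cons !mem_cat vq orbT.
Qed.

(** Block [j] is entered from [X] through [Y], traversed along a Hamiltonian path of [Y :\: R], and
    left from a vertex of [R]. Only [k] candidates in [X] are demanded, as some exits in [R] are
    lost. *)
Lemma open_path G E F k (J : pred I) j w i (X Y : {set V}) :
  (forall u v, u != v -> G u v || G v u) ->
  (forall X Z : {set V}, [disjoint X & Z] -> k <= #|X| -> k <= #|Z| ->
    exists u v, [/\ u \in X, v \in Z & G u v]) ->
  (forall u v, G u v -> E u v || F u v) ->
  {in J, forall i, #|B i| = 8 * k} ->
  {in J &, forall i j, i != j -> [disjoint B i & B j]} ->
  {in J, forall i, {in B i &, forall u v, G u v -> F u v}} -> 0 < k ->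
  all J (i :: j :: w) -> uniq (i :: j :: w) ->
  path (fun i j => ~~ robust E (2 * k) i j) j w ->
  X \subset B i -> k <= #|X| -> Y \subset B j -> #|B j| < #|Y| + 2 * k ->
  {in X & Y, forall u v, G u v -> F u v} ->
  exists x p, [/\ x \in X, path F x p, uniq (x :: p), 2 * k * size w <= size p &
    forall v, v \in p -> exists2 i, i \in j :: w & v \in B i].
Proof.
move=> Gtot Gexp GEF Bk Bd BF k0.
elim: w j i X Y => [|j' w IHw] j i X Y Jw uw pw XB kX YB kY XYF.
  have /card_gt0P[x xX] : 0 < #|X| by exact: leq_trans kX.
  by exists x, [::]; split; rewrite ?muln0.
have Ji : J i by case/and3P: Jw.
have Jj : J j by case/and3P: Jw.
case/andP: pw => /(not_robust GEF)[R [Y' [RB Rk Y'B kY' RY'F]]] pw.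
have [q [Gq uq qZ]] := @tournament_ham_path _ G (Y :\: R) (fun u v _ _ => Gtot u v).
have qB : {subset q <= B j}.
  by move=> v; rewrite qZ inE => /andP[_]; apply: (subsetP YB).
have Fq : sorted F q.
  apply: sub_in_sorted (BF j Jj) _ _ Gq; exact/allP.
have sq : 4 * k < size q.
  rewrite -(card_uniqP uq) (eq_card qZ) cardsD.
  have := subset_leq_card (subsetIr Y R); rewrite Bk // in kY.
  by move: kY; rewrite Rk; clear; lia.
(* [k] vertices for entering, [k] for leaving; more than [2 * k] remain in [qm]. *)
pose qa := take k q; pose qr := drop k q.
pose qm := take (size qr - k) qr; pose qb := drop (size qr - k) qr.
have qE : q = qa ++ qm ++ qb by rewrite !cat_take_drop.
have sr : size qr = size q - k by rewrite size_drop.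
have sa : size qa = k by rewrite size_takel //; move: sq; clear; lia.
have sb : size qb = k by rewrite size_drop sr; move: sq; clear; lia.
have sm : size qm = size q - 2 * k by rewrite size_takel sr; clear; lia.
have ua : uniq qa by rewrite take_uniq.
have ub : uniq qb by rewrite !drop_uniq.
have aq : {subset qa <= q} by move=> v; exact: mem_take.
have bq : {subset qb <= q} by move=> v /mem_drop /mem_drop.
(* By expansion from [qb], fewer than [k] of the [2 * k] vertices of [R] are missed. *)
pose X' := [set v in R | has (fun t => G t v) qb].
have kX' : k <= #|X'|.
  rewrite leqNgt; apply/negP => X'k.
  have [|||t [v [tb vR Gtv]]] := Gexp [set t in qb] (R :\: X').
  - apply/pred0P => v /=; rewrite !inE; apply/negP => /andP[/bq].
    by rewrite qZ inE => /andP[/negbTE -> _]; rewrite andbF.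
  - by rewrite cardsE (card_uniqP ub) sb.
  - rewrite cardsD Rk; have := subset_leq_card (subsetIr R X').
    by move: X'k; clear; lia.
  move: vR; rewrite !inE => /andP[vX' vR]; move: vX'; rewrite vR => /hasPn/(_ t).
  by rewrite inE in tb; rewrite Gtv => /(_ tb).
have X'B : X' \subset B j.
  by apply/subsetP => v; rewrite inE => /andP[/(subsetP RB)].
have X'Y'F : {in X' & Y', forall u v, G u v -> F u v}.
  by move=> u v; rewrite inE => /andP[uR _]; apply: RY'F.
have Jw' : all J (j :: j' :: w) by case/andP: Jw.
have uw' : uniq (j :: j' :: w) by case/andP: uw.
have [x' [p [xX' Fp up sp pB]]] := IHw j' j X' Y' Jw' uw' pw X'B kX' Y'B kY' X'Y'F.
have := xX'; rewrite inE => /andP[xR' /hasP[t tb Gtx']].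
have x'j : x' \in B j := subsetP RB x' xR'.
have Ftx' : F t x' by apply: (BF j Jj) => //; apply/qB/bq.
have ij : [disjoint B i & B j].
  by apply: Bd => //; move: uw; rewrite /= inE negb_or -andbA => /andP[].
have [|||x [z [xX za Gxz]]] := Gexp X [set z in qa] => //.
- apply: disjointWl XB _; apply: disjointWr ij.
  by apply/subsetP => v; rewrite inE => /aq /qB.
- by rewrite cardsE (card_uniqP ua) sa.
rewrite inE in za.
have Fxz : F x z.
  by apply: XYF => //; move: (aq z za); rewrite qZ inE => /andP[].
have [q' [Fq' uq' lq' sq' q'q]] : exists q', [/\ path F z q', uniq (z :: q'),
    last z q' = t, size qm < size q' & {subset z :: q' <= q}].
  by rewrite qE; apply: sorted_segment; rewrite -?qE.
have x'pB v : v \in x' :: p -> exists2 i, i \in j :: j' :: w & v \in B i.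
  rewrite inE => /orP[/eqP->|/pB[j'' jw vj'']]; first by exists j; rewrite ?mem_head.
  by exists j''; rewrite // inE jw orbT.
have restB v : v \in z :: q' ++ x' :: p -> exists2 i, i \in j :: j' :: w & v \in B i.
  rewrite -cat_cons mem_cat => /orP[/q'q/qB vj|/x'pB//].
  by exists j; rewrite ?mem_head.
exists x, (z :: q' ++ x' :: p); split=> //.
- by rewrite /= Fxz cat_path Fq' /= lq' Ftx' Fp.
- rewrite cons_uniq; apply/andP; split.
    apply: (notin_other_blocks Bd Jw _ _ restB); first by case/andP: uw.
    exact: (subsetP XB).
  rewrite -cat_cons cat_uniq uq' up andbT; apply/hasPn => v.
  rewrite inE => /orP[/eqP->|vp]; apply/negP => /q'q.
    by rewrite qZ inE xR'.
  move=> /qB vj; have jw : j \notin j' :: w by case/andP: uw'.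
  by have := notin_other_blocks Bd Jw' jw vj pB; rewrite vp.
rewrite /= size_cat /= mulnS; move: sp sq' sq; rewrite sm; clear; lia.
Qed.
End Chains.

(** * The dichotomy and the constants *)

Lemma mono_path_dichotomy (V : finType) (G : rel V) (n k : nat) (f : coloring V) :
  irreflexive G -> (forall u v, u != v -> G u v || G v u) ->
  (forall X Z : {set V}, [disjoint X & Z] -> k <= #|X| -> k <= #|Z| ->
    exists u v, [/\ u \in X, v \in Z & G u v]) ->
  0 < k -> 3 * n.+1 * (8 * k) <= #|V| ->
  has_mono_path G f red n \/
  exists2 l, 2 * k * n.+1 <= l & has_mono_path G f blue l.
Proof.
move=> Girr Gtot Gexp k0 kV.
have [|nored] := EM (has_mono_path G f red n); first by left.
right; pose E := [rel u v | G u v && (f (u, v) == red)].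
pose F := [rel u v | G u v && (f (u, v) == blue)].
have Eshort x p : path E x p -> uniq (x :: p) -> size p < n.
  move=> xp up; rewrite ltnNge; apply/negP => np; apply: nored.
  exists x, (take n p); split; last exact: size_takel.
    exact: take_path.
  exact: (@take_uniq _ (x :: p) n.+1 up).
have Eirr : irreflexive E by move=> x; rewrite /= Girr.
have [h [hn hE]] := gallai_roy Eirr Eshort.
(* [s] will take at most [n] blocks, leaving [n + 3] for [t]; all but its first and last contribute
   [2 * k] edges each. *)
pose M := 2 * n + 3.
have [|||B0 [Bs Bd Bh]] := @disjoint_blocks V h n (8 * k) M; rewrite ?muln_gt0 //.
  by apply: leq_trans kV; rewrite leq_mul2r /M; lia.
pose B (i : 'I_M) := B0 i.
have GEF u v : G u v -> E u v || F u v by rewrite /= => ->; case: (f _).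
have Bcard i : #|B i| = 8 * k by exact: Bs.
have BD : {in predT &, forall i j : 'I_M, i != j -> [disjoint B i & B j]}.
  by move=> i j _ _ ij; apply: Bd.
have BF : {in predT, forall i, {in B i &, forall u v, G u v -> F u v}}.
  move=> i _ u v ui vi Guv; have /orP[/hE|//] := GEF u v Guv.
  by rewrite (Bh i (ltn_ord i) u v ui vi) eqxx.
have [s [t [rs rt us ut st]]] := bicolored_path_cover (robust B E (2 * k)).
have size_st : size s + size t = M.
  rewrite -[RHS](card_ord M) -(card_uniqP us) -(card_uniqP ut) -(cardC (mem s)).
  by congr (_ + _); apply: eq_card => i; rewrite !inE st negbK.
have sn : size s <= n.
  case: s rs us {st size_st} => [|i s] rs us //.
  have := @robust_path _ _ B E (2 * k) predT i s (B i) BD _ _ us rs (subxx _) _.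
  case; rewrite ?all_predT ?Bcard ?muln_gt0 ?leq_mul2r ?orbT //.
  by move=> x [p [_ xp up sp _]]; rewrite /= -sp; exact: Eshort up.
case: t rt ut size_st {st} => [|i [|j t]] rt ut /=; rewrite /M;
  move=> st; try by exfalso; move: (size s) sn st; clear; lia.
move: rt => /= /andP[/(not_robust GEF)[R [Y [RB Rk YB kY RYF]]] rt].
have := @open_path _ _ B G E F k predT j t i R Y Gtot Gexp GEF.
case; rewrite ?all_predT ?Rk ?leq_pmull //.
move=> x [p [_ xp up kp _]]; exists (size p); last by exists x, p.
apply: leq_trans kp; rewrite leq_mul2l; apply/orP; right.
by move: (size s) (size t) st sn; clear; lia.
Qed.

Local Open Scope ring_scope.

Lemma ltn_mul96_exp2 L : (10 <= L)%N -> (96 * L < 2 ^ L)%N.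
Proof.
elim: L => // L IHL; rewrite leq_eqVlt => /orP[/eqP <- //|L10].
by rewrite expnS; have := IHL L10; lia.
Qed.

Theorem theorem3 (R : realType) :
  exists c : R, 0 < c /\
  exists n0 : nat, forall n : nat, (n0 <= n)%N ->
  exists (V : finType) (G : rel V),
    [/\ oriented_graph G,
        #|edges G|%:R <= c * n%:R ^+ 2 * log2 (n%:R : R) ^+ 2 &
        forall f : coloring V,
          has_mono_path G f red n \/
          exists l : nat,
            n%:R * log2 (n%:R : R) <= l%:R /\ has_mono_path G f blue l].
Proof.
(* There are at most [N * N] edges, and [N = 96 * L * n.+1] is at most [384 * n * T] since
   [L <= 2 * T] and [n.+1 <= 2 * n]. *)
exists (384%:R ^+ 2); split; first by rewrite exprn_gt0 // ltr0n.
exists (2 ^ 10)%N => n n1024.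
pose T := trunc_log 2 n; pose L := T.+1.
have n0 : (0 < n)%N by apply: leq_trans n1024; rewrite expn_gt0.
have Tn : (2 ^ T <= n)%N by exact: trunc_logP.
have nL : (n < 2 ^ L)%N by exact: trunc_log_ltn.
have L10 : (10 < L)%N by rewrite ltnS; exact: trunc_log_max n1024.
(* [N < 2 ^ L * 2 ^ L] gives [N * N < 2 ^ k], while [2 * k * n.+1] exceeds [n * L], hence
   [n * log2 n]. *)
pose k := (4 * L)%N; pose N := (3 * n.+1 * (8 * k))%N.
have NE : N = (96 * L * n.+1)%N by rewrite /N /k; clear; ring.
have Nk : (N * N < 2 ^ k)%N.
  have -> : (2 ^ k = (2 ^ L * 2 ^ L) * (2 ^ L * 2 ^ L))%N.
    by rewrite -!expnD /k; congr (_ ^ _)%N; clear; lia.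
  have NL : (N < 2 ^ L * 2 ^ L)%N.
    rewrite NE (@leq_ltn_trans (96 * L * 2 ^ L)) ?leq_mul2l ?nL ?orbT //.
    by rewrite ltn_pmul2r ?expn_gt0 // ltn_mul96_exp2 // ltnW.
  by rewrite ltn_mul.
have k0 : (0 < k)%N by rewrite muln_gt0.
have [G [Girr Ganti Gexp]] := random_tournament k0 Nk.
have ln2 : 0 < ln (2 : R) by rewrite ln_gt0 // ltr1n.
have n0R : 0 < n%:R :> R by rewrite ltr0n.
have log_le : log2 (n%:R : R) <= L%:R.
  rewrite /log2 ler_pdivrMr // mulr_natl -lnXn ?ltr0n // -natrX.
  by rewrite ler_ln ?posrE ?ltr0n ?expn_gt0 // ler_nat ltnW.
have le_log : T%:R <= log2 (n%:R : R).
  rewrite /log2 ler_pdivlMr // mulr_natl -lnXn ?ltr0n // -natrX.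
  by rewrite ler_ln ?posrE ?ltr0n ?expn_gt0 // ler_nat.
exists 'I_N, G; split.
- split=> [x|x y Gxy]; first by rewrite Girr.
  by rewrite -Ganti //; apply: contraTneq Gxy => ->; rewrite Girr.
- apply: (@le_trans _ _ ((N * N)%:R)).
    by rewrite ler_nat (leq_trans (max_card _)) // card_prod card_ord.
  have log_ge0 : 0 <= log2 (n%:R : R) by apply: le_trans le_log; rewrite ler0n.
  have NR : (N%:R : R) <= 384%:R * n%:R * log2 (n%:R : R).
    apply: (@le_trans _ _ (384 * n * T)%:R); last first.
      by rewrite !natrM ler_wpM2l // mulr_ge0.
    by rewrite ler_nat NE /L; move: L10 n0; clear; nia.
  rewrite natrM -expr2 -!exprMn; apply: lerXn2r => //; rewrite nnegrE ?ler0n //.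
  by apply: le_trans NR; rewrite ler0n.
move=> f; have [||red_path|[l kl blue_path]] :=
  @mono_path_dichotomy _ G n k f Girr _ Gexp k0.
- by move=> u v uv; rewrite Ganti //; case: (G v u).
- by rewrite card_ord.
- by left.
right; exists l; split=> //; apply: le_trans (ler_wpM2l (ltW n0R) log_le) _.
by rewrite -natrM ler_nat; apply: leq_trans kl; rewrite /k; clear; nia.
Qed.
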